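(* There are absolute constants $c_1,c_2>0$ such that $$c_1H\le D_3(3,H)\le c_2H \quad\text{and}\quad c_1H^{3/2}\le D_4(4,H)\le c_2H^{3/2}\quad\text{for every integer } H\ge1,$$ and $$c_1H\log H\le D_4(3,H)\le c_2H\log H\quad\text{for every integer } H\ge 2.$$
   Context: For a polynomial $f$ of degree $n \ge 1$ over $\mathbb{C}$ with roots $\alpha_1,\dots,\alpha_n$ (listed with multiplicity), put $r(f)=\max_{1\le i\le n}|\alpha_i|$. The roots of $f$ of maximal modulus are the roots of modulus $r(f)$; they are always counted with multiplicity. The height of $f$ is the maximum of the absolute values of its coefficients (including the leading one). For positive integers $k\le n$ and $H$, $D_n(k,H)$ denotes the number of monic integer polynomials $f$ of degree $n$ and height at most $H$ with exactly $k$ (not necessarily distinct) roots of maximal modulus. *)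

(* Defs.v *)
From HB Require Import structures.
From mathcomp Require Import all_boot all_order all_algebra.
From mathcomp Require Import finmap.
From mathcomp Require Import all_classical all_reals all_analysis.
From mathcomp Require Import complex.

Set Implicit Arguments.
Unset Strict Implicit.
Unset Printing Implicit Defensive.

Import Order.TTheory GRing.Theory Num.Theory.

Local Open Scope classical_set_scope.
Local Open Scope ring_scope.

Section Roots.
Variable R : realType.

(* The roots listed with multiplicity (for p != 0); well defined up to order. *)
Definition croots (p : {poly R[i]}) : seq R[i] :=
  sval (closed_field_poly_normal p).

Lemma crootsP (p : {poly R[i]}) :
  p = lead_coef p *: \prod_(z <- croots p) ('X - z%:P).
Proof. exact: svalP (closed_field_poly_normal p). Qed.

(* Moduli are nonnegative, so starting the maximum at 0 is harmless as soon as
   p has a root. *)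
Definition max_modulus (p : {poly R[i]}) : R :=
  \big[Num.max/0]_(z <- croots p) ComplexField.Normc.normc z.

Definition num_max_roots (p : {poly R[i]}) : nat :=
  count (fun z => ComplexField.Normc.normc z == max_modulus p) (croots p).

End Roots.

Definition height (f : {poly int}) : nat :=
  \max_(i < size f) absz (f`_i)%R.

Definition Dset (R : realType) (n k H : nat) : set {poly int} :=
  [set f : {poly int} | [/\ f \is monic, size f = n.+1, (height f <= H)%N &
     num_max_roots (map_poly intr f : {poly R[i]}) = k]].

(* [fset_set] returns the empty set on infinite sets, hence this lemma. *)
Lemma finite_Dset (R : realType) (n k H : nat) : finite_set (Dset R n k H).
Proof.
pose F (a : {ffun 'I_n.+1 -> 'I_H.*2.+1}) : {poly int} :=
  \poly_(i < n.+1) ((a (inord i))%:Z - H%:Z).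
apply: (@sub_finite_set _ _ [set F a | a in [set: {ffun 'I_n.+1 -> 'I_H.*2.+1}]]).
  move=> f [_ sf hf _].
  have bound i : (absz (f`_i)%R <= H)%N.
    have [lti|gei] := ltnP i (size f); last by rewrite nth_default.
    apply: leq_trans hf.
    exact: (@leq_bigmax _ (fun j : 'I_(size f) => absz f`_j) (Ordinal lti)).
  have rangei i : 0 <= f`_i + H%:Z <= H.*2%:Z.
    have := bound i; rewrite -lez_nat abszE ler_norml => /andP[h1 h2].
    by rewrite -lerBlDr sub0r h1 /= -addnn PoszD lerD2r.
  exists [ffun i : 'I_n.+1 => inord (absz (f`_i + H%:Z))] => //.
  apply/polyP => i; rewrite coef_poly.
  case: ltnP => [lti|gei]; last by rewrite nth_default ?sf.
  have /andP[h1 h2] := rangei i.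
  rewrite ffunE (inordK lti) inordK; first by rewrite gez0_abs // addrK.
  by rewrite ltnS -lez_nat gez0_abs.
exact/finite_image/finite_finset.
Qed.

Definition D (R : realType) (n k H : nat) : nat := #|` fset_set (Dset R n k H)|.

(* Main.v *)
Require Import Defs.
From mathcomp Require Import all_boot all_order all_algebra finmap.
From mathcomp Require Import all_classical all_reals all_analysis.
From mathcomp Require Import complex ring lra zify.

(** The condition that all roots of a real polynomial lie on the circle
    |z| = r makes it self-reciprocal up to scaling: z |-> r^2 / conj z fixes
    every root.  For a cubic x^3 + a x^2 + b x + c this gives r^2 b = c a and
    c^2 = r^6, so either a = b = 0 (about 2H polynomials) or s = b / a is an
    integer with b = s a, c = s^3 (few polynomials).  A quartic
    x^4 + a x^3 + b x^2 + c x + d satisfies r^2 c = d a and d^2 = r^8: either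
    a = c = 0, where |b| <= 6 sqrt |d| leaves O(H^(3/2)) choices, or
    c = k a and |d| = k^2 for an integer k, and a, b, k are all O(sqrt H).

    If exactly three roots of a quartic have maximal modulus, the fourth, u, is
    real and f = (x - u)(x^3 + A x^2 + s A x + s^3) with s real, |s| = r.  If
    A = 0 then f = (x - n)(x^3 + c) with n, c integers and |n c| <= H, which
    accounts for the main term H log H.  If A <> 0 then u turns out to be the
    only common root of f and of an integer polynomial h, so u is an integer,
    hence so are A and s, and only O(H) polynomials arise. *)

Set Implicit Arguments.
Unset Strict Implicit.
Unset Printing Implicit Defensive.

Import Order.TTheory GRing.Theory Num.Theory.

Local Open Scope ring_scope.

(** * Polynomials with roots of equal modulus *)

Lemma conj_sqnorm (C : numClosedFieldType) (x r : C) :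
  `|x| = r -> x * x^* = r ^+ 2.
Proof. by move=> <-; rewrite -normCK. Qed.

Lemma cubic_circle (C : numClosedFieldType) (x1 x2 x3 r A B D : C) :
  `|x1| = r -> `|x2| = r -> `|x3| = r ->
  A = - (x1 + x2 + x3) -> B = x1 * x2 + x1 * x3 + x2 * x3 ->
  D = - (x1 * x2 * x3) ->
  A \is Num.real -> B \is Num.real -> D \is Num.real ->
  r ^+ 2 * B = D * A /\ D ^+ 2 = r ^+ 6.
Proof.
move=> /conj_sqnorm n1 /conj_sqnorm n2 /conj_sqnorm n3 eA eB eD.
move=> /CrealP rA /CrealP rB /CrealP rD.
have rA' : A = - (x1^* + x2^* + x3^*) by rewrite -rA eA !rmorphN !rmorphD.
have rD' : D = - (x1^* * x2^* * x3^*) by rewrite -rD eD !rmorphN !rmorphM.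
split.
  rewrite {1}rA' eB eD.
  transitivity ((x1 * x1^*) * (x2 * x3) + (x2 * x2^*) * (x1 * x3) +
     (x3 * x3^*) * (x1 * x2)); last by ring.
  by rewrite n1 n2 n3; ring.
rewrite expr2 {1}eD rD'.
transitivity ((x1 * x1^*) * (x2 * x2^*) * (x3 * x3^*)); first by ring.
by rewrite n1 n2 n3; ring.
Qed.

Lemma quartic_circle (C : numClosedFieldType) (x1 x2 x3 x4 r A D E : C) :
  `|x1| = r -> `|x2| = r -> `|x3| = r -> `|x4| = r ->
  A = - (x1 + x2 + x3 + x4) ->
  D = - (x1 * x2 * x3 + x1 * x2 * x4 + x1 * x3 * x4 + x2 * x3 * x4) ->
  E = x1 * x2 * x3 * x4 ->
  A \is Num.real -> D \is Num.real -> E \is Num.real ->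
  r ^+ 2 * D = E * A /\ E ^+ 2 = r ^+ 8.
Proof.
move=> /conj_sqnorm n1 /conj_sqnorm n2 /conj_sqnorm n3 /conj_sqnorm n4 eA eD eE.
move=> /CrealP rA /CrealP rD /CrealP rE.
have rA' : A = - (x1^* + x2^* + x3^* + x4^*).
  by rewrite -rA eA !rmorphN !rmorphD.
have rE' : E = x1^* * x2^* * x3^* * x4^* by rewrite -rE eE !rmorphM.
split.
  rewrite {1}rA' eD eE.
  transitivity (- ((x1 * x1^*) * (x2 * x3 * x4) +
      (x2 * x2^*) * (x1 * x3 * x4) + (x3 * x3^*) * (x1 * x2 * x4) +
      (x4 * x4^*) * (x1 * x2 * x3))); last by ring.
  by rewrite n1 n2 n3 n4; ring.
rewrite expr2 {1}eE rE'.
transitivity ((x1 * x1^*) * (x2 * x2^*) * (x3 * x3^*) * (x4 * x4^*)).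
  by ring.
by rewrite n1 n2 n3 n4; ring.
Qed.

Lemma integer_root (C : numClosedFieldType) (f h : {poly int}) (g : {poly C})
    (u : C) :
  f \is monic -> map_poly intr f = ('X - u%:P) * g ->
  root (map_poly intr h) u ->
  (forall z, root g z -> ~~ root (map_poly intr h) z) ->
  exists n : int, u = n%:~R.
Proof.
move=> mf fE hu gh.
pose toQ := map_poly (intr : int -> rat).
have toQC (p : {poly int}) : map_poly ratr (toQ p) = map_poly intr p
    :> {poly C}.
  by rewrite -map_poly_comp; apply: eq_map_poly => x /=; rewrite ratr_int.
pose F : {poly C} := map_poly intr f; pose G : {poly C} := map_poly intr h.
pose k := gcdp (toQ f) (toQ h).
have kE : map_poly ratr k = gcdp F G.
  by rewrite /F /G -!toQC gcdp_map.
have szk : size k = 2.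
  rewrite -(size_map_poly (ratr : {rmorphism rat -> C})) kE.
  have /dvdpP [l lE] : ('X - u%:P) %| gcdp F G.
    by rewrite dvdp_gcd /F fE dvdp_mulr ?dvdpp // dvdp_XsubCl.
  have lg : l %| g.
    have := dvdp_gcdl F G.
    by rewrite lE /F fE mulrC dvdp_mul2l ?polyXsubC_eq0.
  have lh : l %| G.
    apply: dvdp_trans (dvdp_gcdr F G).
    by rewrite lE dvdp_mulr.
  have sl : size l = 1%N.
    apply/eqP; apply: contraT => /closed_rootP [z lz].
    have gz : root g z.
      by rewrite -dvdp_XsubCl; apply: dvdp_trans lg; rewrite dvdp_XsubCl.
    have hz : root G z.
      by rewrite -dvdp_XsubCl; apply: dvdp_trans lh; rewrite dvdp_XsubCl.
    by have := gh z gz; rewrite hz.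
  by rewrite lE size_Mmonic ?monicXsubC -?size_poly_eq0 ?sl // size_XsubC.
have [p [a a0 kp] [r fpr]] := 
  dvdpP_rat_int (dvdp_gcdl (toQ f) (toQ h) : k %| toQ f).
have sp : size p = 2.
  by rewrite -szk kp size_scale // size_map_inj_poly //; apply: intr_inj.
have lp : lead_coef p * lead_coef r = 1.
  by rewrite -lead_coefM -fpr; apply/monicP.
have pu : root (map_poly intr p) u.
  have : root (map_poly ratr k) u.
    by rewrite kE root_gcd /F /G hu fE rootM root_XsubC eqxx.
  by rewrite kp linearZ /= toQC rootZ ?fmorph_eq0.
have p1E : p`_1 = lead_coef p by rewrite lead_coefE sp.
move: lp; rewrite -p1E => lp.
have pE : (map_poly intr p).[u] = (p`_0)%:~R + (p`_1)%:~R * u.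
  rewrite horner_coef size_map_inj_poly ?sp //; last exact: intr_inj.
  by rewrite 2!big_ord_recl big_ord0 addr0 /= !coef_map /= mulr1 expr1.
move: pu; rewrite rootE pE => /eqP pu0.
exists (- p`_0 * lead_coef r).
have -> : u = (p`_1 * lead_coef r)%:~R * u by rewrite lp mul1r.
rewrite !intrM intrN.
transitivity (((p`_1)%:~R * u) * (lead_coef r)%:~R); first by ring.
congr (_ * _).
by rewrite -[LHS](addrK (p`_0)%:~R) [X in X - _]addrC pu0 sub0r.
Qed.

Lemma intr_exp (R : pzRingType) (n : int) k : (n ^+ k)%:~R = n%:~R ^+ k :> R.
Proof. exact: rmorphXn. Qed.

Lemma prod3E (R : comNzRingType) (x1 x2 x3 : R) :
  \prod_(z <- [:: x1; x2; x3]) ('X - z%:P) =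
  Poly [:: - (x1 * x2 * x3); x1 * x2 + x1 * x3 + x2 * x3; - (x1 + x2 + x3); 1].
Proof.
rewrite !big_cons big_nil /= !cons_poly_def.
by rewrite !(polyCN, polyCD, polyCM) polyC1; ring.
Qed.

Lemma prod4E (R : comNzRingType) (x1 x2 x3 x4 : R) :
  \prod_(z <- [:: x1; x2; x3; x4]) ('X - z%:P) =
  Poly [:: x1 * x2 * x3 * x4;
    - (x1 * x2 * x3 + x1 * x2 * x4 + x1 * x3 * x4 + x2 * x3 * x4);
    x1 * x2 + x1 * x3 + x1 * x4 + x2 * x3 + x2 * x4 + x3 * x4;
    - (x1 + x2 + x3 + x4); 1].
Proof.
rewrite !big_cons big_nil /= !cons_poly_def.
by rewrite !(polyCN, polyCD, polyCM) polyC1; ring.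
Qed.

Lemma coef_intr (C : numClosedFieldType) (f : {poly int}) (s : seq C) i :
  map_poly intr f = Poly s :> {poly C} -> (f`_i)%:~R = s`_i.
Proof.
move=> fE; have := congr1 (fun p : {poly C} => p`_i) fE.
by rewrite /= coef_map => ->; apply: coef_Poly.
Qed.

Lemma norm_sum3 (C : numClosedFieldType) (x1 x2 x3 r : C) :
  `|x1| = r -> `|x2| = r -> `|x3| = r -> `|x1 + x2 + x3| <= 3 * r.
Proof.
move=> n1 n2 n3; have -> : 3 * r = r + r + r by ring.
rewrite (le_trans (ler_normD _ _)) // n3 lerD2r.
by rewrite (le_trans (ler_normD _ _)) // n1 n2.
Qed.

Lemma cubic_equal_moduli (C : numClosedFieldType) (a b c : int)
    (x1 x2 x3 r : C) :
  a%:~R = - (x1 + x2 + x3) -> b%:~R = x1 * x2 + x1 * x3 + x2 * x3 ->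
  c%:~R = - (x1 * x2 * x3) ->
  `|x1| = r -> `|x2| = r -> `|x3| = r ->
  (a = 0 /\ b = 0) \/
  exists s : int, [/\ b = s * a, c = s ^+ 3 & `|a| <= 3 * `|s|].
Proof.
move=> f2 f1 f0 n1 n2 n3.
have [] := cubic_circle n1 n2 n3 f2 f1 f0; rewrite ?realz //.
have r0 : 0 <= r by rewrite -n1.
have [r00|rn0] := eqVneq r 0.
  move=> _ _; left; move: n1 n2 n3; rewrite r00.
  move=> /eqP + /eqP + /eqP; rewrite !normr_eq0 => /eqP x10 /eqP x20 /eqP x30.
  by split; apply: (@intr_inj C); rewrite ?f2 ?f1 x10 x20 x30; ring.
move=> eB eD.
have [A0|An0] := eqVneq a 0.
  left; split => //; apply: (@intr_inj C).
  move: eB; rewrite A0 mulr0 => /eqP; rewrite mulf_eq0 expf_eq0 /= (negbTE rn0).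
  by move/eqP.
right.
have Dn0 : c != 0.
  apply: contraNneq rn0 => D0; move: eD; rewrite D0 mulr0z expr0n /=.
  by move/esym/eqP; rewrite expf_eq0.
have BDA : b ^+ 3 = c * a ^+ 3.
  have DD : c ^+ 2 != 0 by rewrite expf_neq0.
  apply: (mulfI DD); apply: (@intr_inj C).
  rewrite !(intr_exp, intrM).
  transitivity ((r ^+ 2 * (b)%:~R) ^+ 3 : C); first by rewrite eD; ring.
  by rewrite eB; ring.
have : (a ^+ 3 %| b ^+ 3)%Z by rewrite BDA dvdz_mull.
rewrite dvdz_pexp2r // => /dvdzP [s sE].
have Ds : c = s ^+ 3.
  have AA : a ^+ 3 != 0 by rewrite expf_neq0.
  by apply: (mulIf AA); rewrite -BDA sE exprMn.
exists s; split => //.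
have rs : r = `|s%:~R|.
  apply: (@pexpIrn _ 6); rewrite ?nnegrE //.
  rewrite -eD -normrX Ds intr_exp -exprM ger0_norm //.
  by rewrite -[6%N]/(3 * 2)%N exprM real_exprn_even_ge0 // rpredX // realz.
rewrite -(ler_int C) !intr_norm !(intrM, intr_norm) -rs f2 normrN.
exact: norm_sum3.
Qed.

Lemma norm_sum4 (C : numClosedFieldType) (x1 x2 x3 x4 r : C) :
  `|x1| = r -> `|x2| = r -> `|x3| = r -> `|x4| = r ->
  `|x1 + x2 + x3 + x4| <= 4 * r.
Proof.
move=> n1 n2 n3 n4; have -> : 4 * r = 3 * r + r by ring.
by rewrite (le_trans (ler_normD _ _)) // n4 lerD2r norm_sum3.
Qed.

Lemma norm_sum_pairs4 (C : numClosedFieldType) (x1 x2 x3 x4 r : C) :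
  `|x1| = r -> `|x2| = r -> `|x3| = r -> `|x4| = r ->
  `|x1 * x2 + x1 * x3 + x1 * x4 + x2 * x3 + x2 * x4 + x3 * x4| <= 6 * r ^+ 2.
Proof.
move=> n1 n2 n3 n4; have -> : 6 * r ^+ 2 = 4 * r ^+ 2 + r ^+ 2 + r ^+ 2 by ring.
rewrite (le_trans (ler_normD _ _)) // normrM n3 n4 -expr2 lerD2r.
rewrite (le_trans (ler_normD _ _)) // normrM n2 n4 -expr2 lerD2r.
by rewrite norm_sum4 // normrM ?n1 ?n2 ?n3 ?n4 -expr2.
Qed.

Lemma quartic_equal_moduli (C : numClosedFieldType) (a b c d : int)
    (x1 x2 x3 x4 r : C) :
  a%:~R = - (x1 + x2 + x3 + x4) ->
  b%:~R = x1 * x2 + x1 * x3 + x1 * x4 + x2 * x3 + x2 * x4 + x3 * x4 ->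
  c%:~R = - (x1 * x2 * x3 + x1 * x2 * x4 + x1 * x3 * x4 + x2 * x3 * x4) ->
  d%:~R = x1 * x2 * x3 * x4 ->
  `|x1| = r -> `|x2| = r -> `|x3| = r -> `|x4| = r ->
  [/\ a = 0, c = 0 & b ^+ 2 <= 36 * `|d|] \/
  exists k : int, [/\ c = k * a, `|d| = k ^+ 2, `|a| <= 4 * `|k|
    & `|b| <= 6 * `|k|].
Proof.
move=> ea eb ec ed n1 n2 n3 n4.
have := quartic_circle n1 n2 n3 n4 ea ec ed.
rewrite !realz => /(_ isT isT isT) [eC eD].
have r0 : 0 <= r by rewrite -n1.
have nd : `|d%:~R| = r ^+ 4 by rewrite ed !normrM n1 n2 n3 n4; ring.
have nb : `|b%:~R| <= 6 * r ^+ 2 by rewrite eb norm_sum_pairs4.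
have na : `|a%:~R| <= 4 * r by rewrite ea normrN norm_sum4.
have [r00|rn0] := eqVneq r 0.
  move: na nb nd eC; rewrite r00 expr0n /= !mulr0 !normr_le0 !intr_eq0.
  move=> /eqP a0 /eqP b0 _ _; left; split => //; last by rewrite b0; lia.
  move: n1 n2 n3 n4; rewrite r00.
  move=> /eqP + /eqP + /eqP + /eqP.
  rewrite !normr_eq0 => /eqP x10 /eqP x20 /eqP x30 /eqP x40.
  by apply: (@intr_inj C); rewrite ec x10 x20 x30 x40; ring.
have [a0|an0] := eqVneq a 0.
  left; split => //.
    apply/eqP; rewrite -(intr_eq0 C); move: eC; rewrite a0 mulr0 => /eqP.
    by rewrite mulf_eq0 expf_eq0 /= (negbTE rn0).
  rewrite -real_normK ?num_real // -(ler_int C).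
  rewrite !(intr_exp, intrM, intr_norm) nd.
  have -> : 36%:~R * r ^+ 4 = (6 * r ^+ 2) ^+ 2.
    by rewrite -[36%:~R]/(36%:R : C); ring.
  by rewrite lerXn2r // nnegrE // mulr_ge0 // exprn_ge0.
right.
have dn0 : d != 0.
  by rewrite -(intr_eq0 C) -normr_eq0 nd expf_eq0 /= rn0.
have dc : d ^+ 2 * a ^+ 4 = c ^+ 4.
  have DD : d ^+ 2 != 0 by rewrite expf_neq0.
  apply: (mulfI DD); apply: (@intr_inj C).
  rewrite !(intr_exp, intrM).
  transitivity ((r ^+ 2 * c%:~R) ^+ 4 : C); first by rewrite eC; ring.
  by rewrite eD; ring.
have : (a ^+ 4 %| c ^+ 4)%Z by rewrite -dc dvdz_mull.
rewrite dvdz_pexp2r // => /dvdzP [k kE].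
have dk : d ^+ 2 = k ^+ 4.
  have AA : a ^+ 4 != 0 by rewrite expf_neq0.
  by apply: (mulIf AA); rewrite dc kE exprMn.
have dk2 : `|d| = k ^+ 2.
  apply/eqP; rewrite -(@eqrXn2 _ 2) ?sqr_ge0 //.
  by rewrite real_normK ?num_real // dk -exprM.
have rk : r ^+ 2 = `|k%:~R|.
  apply/eqP; rewrite -(@eqrXn2 _ 2) ?sqr_ge0 // ?exprn_ge0 //.
  by rewrite -exprM -nd -intr_norm dk2 intr_exp real_normK ?realz.
have nb' : `|b| <= 6 * `|k|.
  by rewrite -(ler_int C) !(intrM, intr_norm) -rk.
exists k; split => //.
have kn0 : k != 0.
  by move: dn0; apply: contraNneq => k0; rewrite -normr_eq0 dk2 k0.
have a16 : `|a| ^+ 2 <= 16 * `|k|.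
  rewrite -(ler_int C) !(intr_exp, intrM, intr_norm) -rk.
  have -> : 16%:~R * r ^+ 2 = (4 * r) ^+ 2.
    by rewrite -[16%:~R]/(16%:R : C); ring.
  by rewrite lerXn2r // nnegrE // mulr_ge0.
have k1 : 1 <= `|k| by rewrite -gtz0_ge1 normr_gt0.
rewrite -(@ler_pXn2r _ 2) ?nnegrE // (le_trans a16) // exprMn ler_pM2l //.
by rewrite expr2 ler_peMr.
Qed.

Lemma smallest_root_real (C : numClosedFieldType) (f : {poly int})
    (u r : C) (s : seq C) :
  map_poly intr f = \prod_(z <- u :: s) ('X - z%:P) ->
  {in s, forall z, `|z| = r} -> `|u| < r -> u \is Num.real.
Proof.
move=> fE sr ur; apply/CrealP.
have : root (map_poly intr f) u^*.
  have -> : map_poly intr f = map_poly Num.conj (map_poly intr f) :> {poly C}.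
    by rewrite -map_poly_comp; apply: eq_map_poly => x /=; rewrite rmorph_int.
  by rewrite mapf_root fE root_prod_XsubC mem_head.
rewrite fE root_prod_XsubC inE => /predU1P [//|/sr].
by rewrite norm_conjC => ur'; rewrite ur' ltxx in ur.
Qed.

Lemma small_root_integer (C : numClosedFieldType) (f : {poly int})
    (a b c d : int) (x1 x2 x3 u r A s : C) :
  f = Poly [:: d; c; b; a; 1] ->
  map_poly intr f = \prod_(z <- [:: u; x1; x2; x3]) ('X - z%:P) ->
  `|x1| = r -> `|x2| = r -> `|x3| = r -> `|u| < r -> u != 0 ->
  a%:~R = A - u -> b%:~R = s * A - u * A -> d%:~R = - u * s ^+ 3 ->
  A != 0 -> `|s| = r ->
  exists n : int, u = n%:~R.
Proof.
move=> fP fE n1 n2 n3 ur un0 ea eb ed An0 ns.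
have r0 : 0 < r by apply: le_lt_trans ur.
(* f = (x - z)(x^3 + A' x^2 + s' A' x + s'^3) forces A' = a + z,
   s' = (b + z A') / A' and z s'^3 = - d, and h(z) = 0 is this last equation
   with its denominators cleared. *)
pose h : {poly int} :=
  'X * (b%:P + 'X * (a%:P + 'X)) ^+ 3 + d%:P * (a%:P + 'X) ^+ 3.
have hE z : (map_poly intr h).[z] =
    z * (b%:~R + z * (a%:~R + z)) ^+ 3 + d%:~R * (a%:~R + z) ^+ 3 :> C.
  rewrite /h !(rmorphD, rmorphM, rmorphXn) /= !(map_polyX, map_polyC).
  by rewrite !(hornerD, hornerM, horner_exp, hornerX, hornerC).
have fV z : (map_poly intr f).[z] =
    z ^+ 4 + a%:~R * z ^+ 3 + b%:~R * z ^+ 2 + c%:~R * z + d%:~R :> C.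
  rewrite fP /= !cons_poly_def.
  rewrite !(rmorphD, rmorphM) /= !(map_polyX, map_polyC) /= rmorph0.
  by rewrite !(hornerD, hornerM, hornerX, hornerC); ring.
have froot z : root (map_poly intr f) z -> `|z| = r \/ z = u.
  rewrite fE root_prod_XsubC !inE => /or4P [] /eqP ->; by [right|left].
have mf : f \is monic by rewrite monicE lead_coefE fP (@PolyK _ 0).
apply: (@integer_root C f h (\prod_(z <- [:: x1; x2; x3]) ('X - z%:P)) u mf).
- by rewrite fE big_cons.
- by rewrite rootE hE ea eb ed; apply/eqP; ring.
move=> z; rewrite root_prod_XsubC => zx.
have nz : `|z| = r by move: zx; rewrite !inE => /or3P [] /eqP ->.
have zn0 : z != 0 by rewrite -normr_eq0 nz gt_eqF.
have fz : (map_poly intr f).[z] = 0 :> C.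
  by apply/rootP; rewrite fE root_prod_XsubC inE zx orbT.
apply/negP => /rootP; rewrite hE => hz.
have [A0|A'n0] := eqVneq (a%:~R + z) 0.
  move: hz => /eqP; rewrite A0 mulr0 expr0n /= mulr0 !addr0.
  rewrite mulf_eq0 (negbTE zn0).
  rewrite expf_eq0 /= eb -mulrBl mulf_eq0 (negbTE An0) orbF subr_eq0 => /eqP su.
  by move: ur; rewrite -su ns ltxx.
pose A' := a%:~R + z; pose s' := (b%:~R + z * A') / A'.
have A'P : A' != 0 by [].
have s'P : s' * A' = b%:~R + z * A' by rewrite /s' mulfVK.
have zs' : z * s' ^+ 3 = - d%:~R.
  have A3 : A' ^+ 3 != 0 by rewrite expf_neq0.
  apply: (mulIf A3); rewrite -mulrA -exprMn s'P mulNr.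
  by apply/eqP; rewrite -addr_eq0; apply/eqP.
have fs' : root (map_poly intr f) (- s').
  have aE : a%:~R = A' - z by rewrite /A' addrK.
  have bE : b%:~R = s' * A' - z * A' by rewrite s'P addrK.
  have dE : d%:~R = - z * s' ^+ 3 by rewrite mulNr zs' opprK.
  have cE : c%:~R = s' ^+ 3 - z * s' * A'.
    apply: (mulIf zn0); move: fz; rewrite fV aE bE dE => fz.
    rewrite -[LHS]subr0 -fz; ring.
  by rewrite rootE fV aE bE cE dE; apply/eqP; ring.
have nzs : r * `|s'| ^+ 3 = `|u| * r ^+ 3.
  by rewrite -nz -normrX -normrM zs' ed mulNr opprK normrM normrX ns nz.
have nu0 : `|u| != 0 by rewrite normr_eq0.
have rn0 : r != 0 by rewrite gt_eqF.
case: (froot _ fs') => [|s'u].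
  rewrite normrN => s'r; move: nzs; rewrite s'r.
  have r3 : r ^+ 3 != 0 by rewrite expf_neq0.
  by move=> /(mulIf r3) ru; move: ur; rewrite -ru ltxx.
have : `|s'| = `|u| by rewrite -s'u normrN.
move=> s'n; move: nzs; rewrite s'n => /eqP.
have -> : r * `|u| ^+ 3 = (r * `|u|) * `|u| ^+ 2 by ring.
have -> : `|u| * r ^+ 3 = (r * `|u|) * r ^+ 2 by ring.
rewrite (inj_eq (mulfI _)) ?mulf_neq0 // eqrXn2 ?(ltW r0) // => /eqP ur'.
by move: ur; rewrite ur' ltxx.
Qed.

Lemma quartic_three_max_moduli (C : numClosedFieldType) (f : {poly int})
    (a b c d : int) (x1 x2 x3 u r : C) :
  f = Poly [:: d; c; b; a; 1] ->
  map_poly intr f = \prod_(z <- [:: u; x1; x2; x3]) ('X - z%:P) ->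
  `|x1| = r -> `|x2| = r -> `|x3| = r -> `|u| < r ->
  (exists n : int, [/\ a = - n, b = 0, d = - (n * c) & c != 0]) \/
  exists A n s : int, [/\ [/\ a = A - n, b = s * A - n * A,
      c = s ^+ 3 - n * s * A & d = - n * s ^+ 3],
      `|n| <= `|s| & `|A| <= 3 * `|s|].
Proof.
move=> fP fE n1 n2 n3 ur.
have r0 : 0 < r by apply: le_lt_trans ur.
have rn0 : r != 0 by rewrite gt_eqF.
have uR : u \is Num.real.
  apply: smallest_root_real fE _ ur => z; rewrite !inE.
  by move=> /or3P [] /eqP ->.
have fE' := fE; rewrite prod4E in fE'.
have cf i : (f`_i)%:~R = _ := coef_intr i fE'.
have := (cf 0, cf 1, cf 2, cf 3).
rewrite fP !coef_Poly /= => -[[[ed ec] eb] ea].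
pose A := - (x1 + x2 + x3); pose B := x1 * x2 + x1 * x3 + x2 * x3.
pose D := - (x1 * x2 * x3).
have aE : a%:~R = A - u by rewrite ea /A; ring.
have bE : b%:~R = B - u * A by rewrite eb /A /B; ring.
have cE : c%:~R = D - u * B by rewrite ec /B /D; ring.
have dE : d%:~R = - u * D by rewrite ed /D; ring.
have AR : A \is Num.real by rewrite -[A](subrK u) -aE rpredD // realz.
have BR : B \is Num.real.
  by rewrite -[B](subrK (u * A)) -bE rpredD ?rpredM // realz.
have DR : D \is Num.real.
  by rewrite -[D](subrK (u * B)) -cE rpredD ?rpredM // realz.
have [eB eD] := cubic_circle n1 n2 n3 (erefl A) (erefl B) (erefl D) AR BR DR.
have Dn0 : D != 0.
  have : D ^+ 2 != 0 by rewrite eD expf_neq0.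
  by rewrite expf_eq0.
have [A0|An0] := eqVneq A 0.
  have B0 : B = 0.
    move: eB => /eqP; rewrite A0 mulr0 mulf_eq0 expf_eq0 /= (negbTE rn0).
    by move/eqP.
  move: aE bE cE dE; rewrite A0 B0 !mulr0 !subr0 sub0r => aE bE cE dE.
  left; exists (- a); split; rewrite ?opprK //.
  - by apply/eqP; rewrite -(intr_eq0 C) bE.
  - by apply: (@intr_inj C); rewrite mulNr opprK intrM aE cE dE.
  - by rewrite -(intr_eq0 C) cE.
right.
have BDA : B ^+ 3 = D * A ^+ 3.
  have DD : D ^+ 2 != 0 by rewrite expf_neq0.
  apply: (mulfI DD).
  transitivity ((r ^+ 2 * B) ^+ 3); first by rewrite eD; ring.
  by rewrite eB; ring.
pose s := B / A.
have BE : B = s * A by rewrite /s mulfVK.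
have DE : D = s ^+ 3.
  have A3 : A ^+ 3 != 0 by rewrite expf_neq0.
  by apply: (mulIf A3); rewrite -BDA BE exprMn.
have ns : `|s| = r.
  apply: (@pexpIrn _ 6); rewrite ?nnegrE ?(ltW r0) //.
  rewrite -normrX -eD DE ger0_norm -?exprM // -[6%N]/(3 * 2)%N exprM.
  by rewrite real_exprn_even_ge0 // rpredX // /s rpred_div.
have [n un] : exists n : int, u = n%:~R.
  have [->|un0] := eqVneq u 0; first by exists 0.
  apply: (small_root_integer fP fE n1 n2 n3 ur un0 aE (s := s) _ _ An0 ns).
    by rewrite bE BE.
  by rewrite dE DE.
have AE : A = (a + n)%:~R by rewrite intrD aE -un subrK.
have BE' : B = (b + n * (a + n))%:~R by rewrite intrD intrM -AE bE -un subrK.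
have DE' : D = (c + n * (b + n * (a + n)))%:~R.
  by rewrite intrD intrM -BE' cE -un subrK.
have : ((a + n) ^+ 3 %| (b + n * (a + n)) ^+ 3)%Z.
  apply/dvdzP; exists (c + n * (b + n * (a + n))).
  by apply: (@intr_inj C); rewrite !(intr_exp, intrM) -AE -BE' -DE' BDA.
rewrite dvdz_pexp2r // => /dvdzP [k kE].
have sk : s = k%:~R by rewrite /s BE' kE intrM -AE mulfK.
exists (a + n), n, k; split.
- split; apply: (@intr_inj C);
    rewrite !(rmorphB, rmorphM, rmorphN, intr_exp) /=.
  + by rewrite -AE -un aE.
  + by rewrite -AE -un -sk bE BE.
  + by rewrite -AE -un -sk cE BE DE; ring.
  + by rewrite -un -sk dE DE.
- by rewrite -(ler_int C) !intr_norm -un -sk ns ltW.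
- rewrite -(ler_int C) !(intrM, intr_norm) -AE -sk ns /A normrN.
  exact: norm_sum3.
Qed.

(** * Roots of maximal modulus *)

Lemma normC_normc (R : realType) (z : R[i]) :
  `|z| = (ComplexField.Normc.normc z)%:C%C.
Proof. by case: z. Qed.

Lemma le_max_modulus (R : realType) (p : {poly R[i]}) :
  {in croots p, forall z, `|z| <= (max_modulus p)%:C%C}.
Proof.
move=> z zp; rewrite normC_normc lecR.
exact: le_bigmax_seq.
Qed.

Lemma num_max_rootsE (R : realType) (p : {poly R[i]}) :
  num_max_roots p = count (fun z => `|z| == (max_modulus p)%:C%C) (croots p).
Proof.
by apply: eq_count => z; rewrite normC_normc (inj_eq (@complexI _)).
Qed.

Lemma croots_prod (R : realType) (p : {poly R[i]}) : p \is monic ->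
  p = \prod_(z <- croots p) ('X - z%:P).
Proof. by move=> mp; rewrite {1}(crootsP p) (monicP mp) scale1r. Qed.

Lemma size_croots (R : realType) (p : {poly R[i]}) : p \is monic ->
  size p = (size (croots p)).+1.
Proof. by move=> mp; rewrite {1}(croots_prod mp) size_prod_XsubC. Qed.

Lemma root_croots (R : realType) (p : {poly R[i]}) z : p \is monic ->
  z \in croots p -> root p z.
Proof. by move=> mp zp; rewrite (croots_prod mp) root_prod_XsubC. Qed.

Lemma num_max_roots_count (R : realType) (p : {poly R[i]}) (s : seq R[i]) r :
  p = \prod_(z <- s) ('X - z%:P) ->
  {in s, forall z, `|z| <= r} -> has (fun z => `|z| == r) s ->
  num_max_roots p = count (fun z => `|z| == r) s.
Proof.
move=> pE sr /hasP [w ws /eqP wr].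
have mp : p \is monic by rewrite pE monic_prod_XsubC.
have ps : perm_eq (croots p) s.
  by apply: prod_XsubC_eq; rewrite -croots_prod.
suff <- : (max_modulus p)%:C%C = r.
  by rewrite num_max_rootsE; apply/permP.
apply/eqP; rewrite eq_le -{2}wr le_max_modulus ?(perm_mem ps) // andbT.
rewrite -wr normC_normc lecR /max_modulus big_seq.
apply: bigmax_le => [|z]; first by rewrite -lecR -normC_normc normr_ge0.
by rewrite (perm_mem ps) -lecR -!normC_normc wr => /sr.
Qed.

Lemma num_max_roots_all (R : realType) (p : {poly R[i]}) n (r : R[i]) :
  p \is monic -> size p = n.+2 -> (forall z, root p z -> `|z| = r) ->
  num_max_roots p = n.+1.
Proof.
move=> mp sp pr; have := sp; rewrite size_croots // => -[sc].
have cr : {in croots p, forall z, `|z| = r}.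
  by move=> z /(root_croots mp) /pr.
rewrite (num_max_roots_count (croots_prod mp) (r := r)).
- rewrite -sc; apply/eqP; rewrite -all_count; apply/allP => z /cr ->.
  exact: eqxx.
- by move=> z /cr ->.
- case: (croots p) cr sc => // z s cr _; rewrite /= (cr z) ?mem_head //.
  by rewrite eqxx.
Qed.

Lemma Dset_roots (R : realType) n k H (f : {poly int}) : Dset R n k H f ->
  exists (s : seq R[i]) (r : R[i]),
    [/\ size s = n, map_poly intr f = \prod_(z <- s) ('X - z%:P),
        {in s, forall z, `|z| <= r} & count (fun z => `|z| == r) s = k].
Proof.
case=> mf sf _ <-; set p : {poly R[i]} := map_poly intr f.
have mp : p \is monic by apply: monic_map.
exists (croots p), (max_modulus p)%:C%C; split.
- apply: succn_inj; rewrite -size_croots // -sf size_map_inj_poly //.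
  exact: intr_inj.
- exact: croots_prod.
- exact: le_max_modulus.
- by rewrite num_max_rootsE.
Qed.

Lemma coef_height (f : {poly int}) i : (absz (f`_i)%R <= height f)%N.
Proof.
have [lti|gei] := ltnP i (size f); last by rewrite nth_default.
exact: (@leq_bigmax _ (fun j : 'I_(size f) => absz f`_j) (Ordinal lti)).
Qed.

Lemma height_Poly (s : seq int) (H : nat) :
  all (fun x : int => (absz x <= H)%N) s -> (height (Poly s) <= H)%N.
Proof.
move=> /allP sH; apply/bigmax_leqP => i _; rewrite coef_Poly.
have [lti|gei] := ltnP i (size s); last by rewrite nth_default.
exact/sH/mem_nth.
Qed.

Lemma D_le (R : realType) n k H (L : seq {poly int}) :
  (forall f, Dset R n k H f -> f \in L) -> (D R n k H <= size L)%N.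
Proof.
move=> DL; apply: uniq_leq_size; first exact: fset_uniq.
move=> f; rewrite in_fset_set; last exact: finite_Dset.
by rewrite inE => /DL.
Qed.

Lemma D_ge (R : realType) n k H (L : seq {poly int}) : uniq L ->
  (forall f, f \in L -> Dset R n k H f) -> (size L <= D R n k H)%N.
Proof.
move=> uL DL; apply: uniq_leq_size => // f fL.
rewrite in_fset_set; last exact: finite_Dset.
by rewrite inE; apply: DL.
Qed.

Lemma monic_Poly (s : seq int) n : size s = n ->
  Poly (rcons s 1) \is monic /\ size (Poly (rcons s 1)) = n.+1.
Proof.
move=> ss; have sE : Poly (rcons s 1) = rcons s 1 :> seq int.
  by apply: (@PolyK _ 0); rewrite last_rcons.
split; last by rewrite sE size_rcons ss.
by rewrite monicE lead_coefE sE size_rcons /= nth_rcons ltnn eqxx.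
Qed.

Lemma cubic_coefs (f : {poly int}) : f \is monic -> size f = 4 ->
  f = Poly [:: f`_0; f`_1; f`_2; 1].
Proof.
move=> mf sf; apply/polyP => i; rewrite coef_Poly.
case: i => [|[|[|[|i]]]] //=; last by rewrite nth_nil nth_default ?sf.
by move/monicP: mf; rewrite lead_coefE sf.
Qed.

Lemma quartic_coefs (f : {poly int}) : f \is monic -> size f = 5 ->
  f = Poly [:: f`_0; f`_1; f`_2; f`_3; 1].
Proof.
move=> mf sf; apply/polyP => i; rewrite coef_Poly.
case: i => [|[|[|[|[|i]]]]] //=; last by rewrite nth_nil nth_default ?sf.
by move/monicP: mf; rewrite lead_coefE sf.
Qed.

Lemma Dset33_param (R : realType) H (f : {poly int}) : Dset R 3 3 H f ->
  (exists2 c : int, `|c| <= H%:Z & f = Poly [:: c; 0; 0; 1]) \/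
  (exists a s : int, [/\ `|s| ^+ 3 <= H%:Z, `|a| <= 3 * `|s|
     & f = Poly [:: s ^+ 3; s * a; a; 1]]).
Proof.
move=> Df; have [s [r [ss fE _ /esym cr]]] := Dset_roots Df.
case: Df => mf sf hf _; move: cr; rewrite -[LHS]ss => /esym/eqP.
rewrite -all_count => /allP sr.
have f0H : `|f`_0| <= H%:Z.
  by rewrite -abszE lez_nat (leq_trans (coef_height f 0)).
case: s ss fE sr => // x1 [|x2 [|x3 [|]]] //= _ fE sr.
have n1 : `|x1| = r by apply/eqP/sr; rewrite !inE eqxx.
have n2 : `|x2| = r by apply/eqP/sr; rewrite !inE eqxx orbT.
have n3 : `|x3| = r by apply/eqP/sr; rewrite !inE eqxx !orbT.
rewrite prod3E in fE.
have cf i : (f`_i)%:~R = _ := coef_intr i fE.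
case: (cubic_equal_moduli (cf 2) (cf 1) (cf 0) n1 n2 n3).
  move=> [a0 b0]; left; exists f`_0 => //.
  by rewrite {1}(cubic_coefs mf sf) a0 b0.
move=> [k [bE cE ak]]; right; exists f`_2, k; split => //.
  by rewrite -normrX -cE.
by rewrite {1}(cubic_coefs mf sf) -cE -bE.
Qed.

Lemma Dset44_param (R : realType) H (f : {poly int}) : Dset R 4 4 H f ->
  (exists b d : int, [/\ `|d| <= H%:Z, b ^+ 2 <= 36 * H%:Z
     & f = Poly [:: d; 0; b; 0; 1]]) \/
  (exists a b d k : int, [/\ [/\ `|d| = k ^+ 2, `|a| <= 4 * `|k| &
     `|b| <= 6 * `|k|], k ^+ 2 <= H%:Z & f = Poly [:: d; k * a; b; a; 1]]).
Proof.
move=> Df; have [s [r [ss fE _ /esym cr]]] := Dset_roots Df.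
case: Df => mf sf hf _; move: cr; rewrite -[LHS]ss => /esym/eqP.
rewrite -all_count => /allP sr.
have f0H : `|f`_0| <= H%:Z.
  by rewrite -abszE lez_nat (leq_trans (coef_height f 0)).
case: s ss fE sr => // x1 [|x2 [|x3 [|x4 [|]]]] //= _ fE sr.
have n1 : `|x1| = r by apply/eqP/sr; rewrite !inE eqxx.
have n2 : `|x2| = r by apply/eqP/sr; rewrite !inE eqxx orbT.
have n3 : `|x3| = r by apply/eqP/sr; rewrite !inE eqxx !orbT.
have n4 : `|x4| = r by apply/eqP/sr; rewrite !inE eqxx !orbT.
rewrite prod4E in fE.
have cf i : (f`_i)%:~R = _ := coef_intr i fE.
case: (quartic_equal_moduli (cf 3) (cf 2) (cf 1) (cf 0) n1 n2 n3 n4).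
  move=> [a0 c0 bd]; left; exists f`_2, f`_0; split => //.
    by rewrite (le_trans bd) // ler_pM2l.
  by rewrite {1}(quartic_coefs mf sf) a0 c0.
move=> [k [cE dk ak bk]]; right; exists f`_3, f`_2, f`_0, k; split => //.
  by rewrite -dk.
by rewrite {1}(quartic_coefs mf sf) -cE.
Qed.

Lemma Dset43_param (R : realType) H (f : {poly int}) : Dset R 4 3 H f ->
  (exists n c : int, [/\ c != 0, `|c| <= H%:Z, `|n * c| <= H%:Z
     & f = Poly [:: - (n * c); c; 0; - n; 1]]) \/
  (exists A n s : int, [/\ [/\ `|n| <= `|s| & `|A| <= 3 * `|s|],
     `|s| ^+ 3 <= H%:Z & f = Poly [:: - n * s ^+ 3; s ^+ 3 - n * s * A;
        s * A - n * A; A - n; 1]]).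
Proof.
move=> Df; have [s [r [ss fE sler cr]]] := Dset_roots Df.
case: Df => mf sf hf _.
have fH i : `|f`_i| <= H%:Z.
  by rewrite -abszE lez_nat (leq_trans (coef_height f i)).
have : has (predC (fun z => `|z| == r)) s.
  by rewrite has_predC all_count cr ss.
case/hasP => u us /= ur.
have pu := perm_to_rem us.
have urr : `|u| < r by rewrite lt_def eq_sym ur sler.
have : all (fun z => `|z| == r) (rem u s).
  by rewrite all_count size_rem // ss -cr (permP pu) /= (negbTE ur).
move=> /allP; have : size (rem u s) = 3%N by rewrite size_rem // ss.
rewrite (perm_big _ pu) /= in fE.
case: (rem u s) fE => // x1 [|x2 [|x3 [|]]] //= fE _ sr.
have n1 : `|x1| = r by apply/eqP/sr; rewrite !inE eqxx.
have n2 : `|x2| = r by apply/eqP/sr; rewrite !inE eqxx orbT.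
have n3 : `|x3| = r by apply/eqP/sr; rewrite !inE eqxx !orbT.
have fP := quartic_coefs mf sf.
case: (quartic_three_max_moduli fP fE n1 n2 n3 urr).
  move=> [n [aE bE dE cn0]]; left; exists n, f`_1; split => //.
    by rewrite -normrN -dE fH.
  by rewrite {1}fP aE bE dE.
move=> [A [n [k [[aE bE cE dE] nk Ak]]]]; right; exists A, n, k; split => //.
  have := fH 0; have := fH 1; rewrite dE cE normrM normrN normrX.
  have [->|n0] := eqVneq n 0; first by rewrite !mul0r subr0 normrX.
  move=> _; apply: le_trans; rewrite ler_peMl // ?exprn_ge0 //.
  by rewrite -gtz0_ge1 normr_gt0.
by rewrite fP aE bE cE dE.
Qed.

Lemma map_Poly (R : realType) (s : seq int) :
  map_poly intr (Poly s) = Poly (map intr s) :> {poly R[i]}.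
Proof.
apply/polyP => i; rewrite coef_map /= coef_Poly.
transitivity ((map intr s : seq R[i])`_i); last by rewrite coef_Poly.
have [lti|gei] := ltnP i (size s); first by rewrite (nth_map 0).
by rewrite !nth_default ?size_map.
Qed.

Lemma normX_root (C : numClosedFieldType) (z : C) (c n : nat) : (0 < n)%N ->
  `|z| ^+ n = c%:R -> `|z| = n.-root c%:R.
Proof. by move=> n0 <-; rewrite exprCK. Qed.

Lemma cubic_binomial_root (R : realType) (c : int) (z : R[i]) :
  root (map_poly intr (Poly [:: c; 0; 0; 1])) z ->
  `|z| = 3.-root (absz c)%:R.
Proof.
move=> /rootP zr; apply: normX_root => //.
have : z ^+ 3 = - c%:~R.
  move: zr; rewrite map_Poly /= !cons_poly_def.
  rewrite !(hornerD, hornerM, hornerX, hornerC) => /eqP.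
  rewrite -[X in X == 0]/(_ + c%:~R) addr_eq0 => /eqP <-; ring.
move=> zE; by rewrite -normrX zE normrN -intr_norm -abszE.
Qed.

Lemma Dset33_mem (R : realType) H (c : nat) : (c <= H)%N -> (0 < H)%N ->
  Dset R 3 3 H (Poly [:: c%:Z; 0; 0; 1]).
Proof.
move=> cH H0; have [mf sf] := @monic_Poly [:: c%:Z; 0; 0] 3 erefl.
split => //; first by apply: height_Poly; rewrite /= cH H0.
apply: (@num_max_roots_all _ _ _ (3.-root c%:R)).
- exact: monic_map.
- by rewrite size_map_inj_poly //; exact: intr_inj.
- by move=> z /cubic_binomial_root ->; rewrite absz_nat.
Qed.

Lemma biquadratic_root_norm (C : numClosedFieldType) (b d y : C) :
  b \is Num.real -> 0 <= d -> b ^+ 2 <= 4 * d ->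
  y ^+ 2 + b * y + d = 0 -> `|y| ^+ 2 = d.
Proof.
move=> bR d0 bd yE.
pose w := y + b / 2; pose e := d - b ^+ 2 / 4.
have e0 : 0 <= e by rewrite subr_ge0 ler_pdivrMr // mulrC.
have wE : w ^+ 2 = - e.
  apply/eqP; rewrite -subr_eq0 -[X in _ == X]yE /w /e opprK; apply/eqP.
  by field.
have ww : w * w^* = e.
  rewrite -normCK; have : (`|w| ^+ 2) = e; last by [].
  by rewrite -normrX wE normrN ger0_norm.
have bJ : (b / 2)^* = b / 2 by apply/CrealP; rewrite rpred_div ?realn.
have wJ : w^* = - w.
  have [w0|wn0] := eqVneq w 0; first by rewrite w0 rmorph0 oppr0.
  by apply: (mulfI wn0); rewrite ww mulrN -expr2 wE opprK.
have yw : y = w - b / 2 by rewrite /w addrK.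
rewrite normCK yw rmorphB /= wJ bJ.
transitivity (- w ^+ 2 + b ^+ 2 / 4); first by field.
by rewrite wE opprK /e subrK.
Qed.

Lemma Dset44_mem (R : realType) H (b d : nat) : (0 < d <= H)%N ->
  (b <= H)%N -> (b ^ 2 <= 4 * d)%N ->
  Dset R 4 4 H (Poly [:: d%:Z; 0; b%:Z; 0; 1]).
Proof.
move=> /andP [d0 dH] bH bd; have H0 := leq_trans d0 dH.
have [mf sf] := @monic_Poly [:: d%:Z; 0; b%:Z; 0] 4 erefl.
split => //; first by apply: height_Poly; rewrite /= dH bH H0.
apply: (@num_max_roots_all _ _ _ (4.-root d%:R)).
- exact: monic_map.
- by rewrite size_map_inj_poly //; exact: intr_inj.
move=> z /rootP; rewrite map_Poly /= !cons_poly_def.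
rewrite !(hornerD, hornerM, hornerX, hornerC) => zr.
apply: normX_root => //; rewrite -[4%N]/(2 * 2)%N exprM -normrX.
apply: (@biquadratic_root_norm _ b%:R); rewrite ?realn ?ler0n //.
  by rewrite -natrX -natrM ler_nat.
by rewrite -zr /=; ring.
Qed.

Lemma Dset43_mem (R : realType) H (n c : nat) : (n ^ 3 < c <= H)%N ->
  (n * c <= H)%N -> Dset R 4 3 H (Poly [:: (n * c)%:Z; - c%:Z; 0; - n%:Z; 1]).
Proof.
move=> /andP [nc cH] ncH; have c0 : (0 < c)%N by case: c nc {cH ncH}.
have nH : (n <= H)%N by rewrite (leq_trans _ ncH) // leq_pmulr.
have H0 := leq_trans c0 cH.
have [mf sf] := @monic_Poly [:: (n * c)%:Z; - c%:Z; 0; - n%:Z] 4 erefl.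
split => //; first by apply: height_Poly; rewrite /= !abszN /= ncH cH nH H0.
set p := map_poly _ _.
pose g : {poly R[i]} := map_poly intr (Poly [:: - c%:Z; 0; 0; 1]).
have [mg sg] := @monic_Poly [:: - c%:Z; 0; 0] 3 erefl.
have mg' : g \is monic by apply: monic_map.
have sg' : size g = 4 by rewrite size_map_inj_poly //; exact: intr_inj.
have pE : p = \prod_(z <- n%:R :: croots g) ('X - z%:P).
  rewrite big_cons -croots_prod // /p /g !map_Poly /= !cons_poly_def.
  by rewrite !intrN PoszM intrM !(polyCN, polyCD, polyCM) polyC0; ring.
have gr : {in croots g, forall z, `|z| = 3.-root c%:R}.
  move=> z /(root_croots mg') /cubic_binomial_root ->.
  by rewrite abszN absz_nat.
have nr : `|n%:R| < 3.-root c%:R :> R[i].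
  rewrite normr_nat -[_%:R](@exprCK _ 3) ?ler0n //.
  rewrite ltr_rootC ?nnegrE ?exprn_ge0 //.
  by rewrite -natrX ltr_nat.
rewrite (num_max_roots_count pE (r := 3.-root c%:R)) /=.
- have := size_croots mg'; rewrite sg' => -[sc].
  rewrite lt_eqF // add0n [RHS]sc.
  by apply/eqP; rewrite -all_count; apply/allP => z /gr ->.
- by move=> z; rewrite inE => /predU1P [->|/gr ->] //; apply: ltW.
- apply/orP; right; have := size_croots mg'; rewrite sg'.
  by case: (croots g) gr => // z s gr _; rewrite /= gr ?mem_head // eqxx.
Qed.

(** * Counting *)

Definition irange (N : nat) : seq int :=
  [seq i%:Z - N%:Z | i <- iota 0 (N.*2.+1)].

Lemma size_irange N : size (irange N) = N.*2.+1.
Proof. by rewrite size_map size_iota. Qed.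

Lemma mem_irange (N : nat) (x : int) : `|x| <= N%:Z -> x \in irange N.
Proof.
move=> xN; apply/mapP; exists (absz (x + N%:Z)); last by lia.
by rewrite mem_iota; lia.
Qed.

Lemma floor_root k H : (0 < k)%N -> (0 < H)%N ->
  exists m, [/\ (0 < m)%N, (m ^ k <= H)%N & (H < m.+1 ^ k)%N].
Proof.
move=> k0 H0.
have ex : exists m, (m ^ k <= H)%N by exists 0%N; rewrite exp0n.
have ub m : (m ^ k <= H)%N -> (m <= H)%N.
  apply: leq_trans; rewrite -{1}(expn1 m).
  by case: m => [|m]; rewrite ?exp0n ?leq_pexp2l.
case: (ex_maxnP ex ub) => m mH mmax; exists m; split => //.
  by apply: mmax; rewrite exp1n.
by rewrite ltnNge; apply/negP => /mmax; rewrite ltnn.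
Qed.

Lemma absz_le_root (k H m : nat) (x : int) : (0 < k)%N ->
  `|x| ^+ k <= H%:Z -> (H < m.+1 ^ k)%N -> `|x| <= m%:Z.
Proof.
move=> k0; rewrite -!abszE -!natz -natrX !natz !lez_nat => xH Hm.
by rewrite -ltnS -(ltn_exp2r _ _ k0) (leq_ltn_trans xH).
Qed.

Lemma cubic_Poly_inj (a b c a' b' c' : int) :
  Poly [:: a; b; c; 1] = Poly [:: a'; b'; c'; 1] ->
  [/\ a = a', b = b' & c = c'].
Proof.
move=> e; have ci i : [:: a; b; c; 1]`_i = [:: a'; b'; c'; 1]`_i.
  by rewrite -coef_Poly e coef_Poly.
by have := (ci 0, ci 1, ci 2); move=> /= -[[-> ->] ->].
Qed.

Lemma quartic_Poly_inj (a b c d a' b' c' d' : int) :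
  Poly [:: a; b; c; d; 1] = Poly [:: a'; b'; c'; d'; 1] ->
  [/\ a = a', b = b', c = c' & d = d'].
Proof.
move=> e; have ci i : [:: a; b; c; d; 1]`_i = [:: a'; b'; c'; d'; 1]`_i.
  by rewrite -coef_Poly e coef_Poly.
by have := (ci 0, ci 1, ci 2, ci 3); move=> /= -[[[-> ->] ->] ->].
Qed.

Lemma D33_le (R : realType) H : (0 < H)%N -> (D R 3 3 H <= 24 * H)%N.
Proof.
move=> H0; have [m [m0 mH Hm]] := @floor_root 3 H isT H0.
pose L := [seq Poly [:: c; 0; 0; 1] | c <- irange H] ++
  [seq Poly [:: s ^+ 3; s * a; a; 1] | a <- irange (3 * m), s <- irange m].
apply: leq_trans (@D_le R 3 3 H L _) _; last first.
  rewrite /L size_cat size_map size_allpairs !size_irange.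
  have : (m * m <= m ^ 3)%N by rewrite -[(m * m)%N]/(m ^ 2)%N leq_pexp2l.
  nia.
move=> f /Dset33_param [[c cH ->]|[a [s [sH as3 ->]]]]; rewrite mem_cat.
  apply/orP; left; apply: (map_f (fun c => Poly [:: c; 0; 0; 1])).
  exact: mem_irange.
have sm := @absz_le_root 3 H m s isT sH Hm.
apply/orP; right.
by apply: (allpairs_f (fun a s => Poly [:: s ^+ 3; s * a; a; 1]));
  apply: mem_irange; lia.
Qed.

Lemma D33_ge (R : realType) H : (H <= D R 3 3 H)%N.
Proof.
pose L : seq {poly int} := [seq Poly [:: c%:Z; 0; 0; 1] | c <- iota 1 H].
have -> : H = size L by rewrite size_map size_iota.
apply: D_ge.
  by rewrite map_inj_uniq ?iota_uniq // => x y /cubic_Poly_inj [[]].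
move=> f /mapP [c]; rewrite mem_iota => cH ->.
by apply: Dset33_mem; rewrite size_map size_iota; lia.
Qed.

Lemma D44_le (R : realType) H m : (0 < m)%N -> (m ^ 2 <= H)%N ->
  (H < m.+1 ^ 2)%N -> (D R 4 4 H <= 777 * (H * m))%N.
Proof.
move=> m0 mH Hm.
pose L := [seq Poly [:: d; 0; b; 0; 1] | b <- irange (12 * m), d <- irange H] ++
  [seq Poly [:: ek.1 * ek.2 ^+ 2; ek.2 * ab.1; ab.2; ab.1; 1] |
     ab <- [seq (a, b) | a <- irange (4 * m), b <- irange (6 * m)],
     ek <- [seq (e, k) | e <- [:: 1; -1], k <- irange m]].
apply: leq_trans (@D_le R 4 4 H L _) _; last first.
  rewrite /L size_cat !size_allpairs !size_irange /=.
  apply: (@leq_trans (25 * m * (3 * H) + 9 * m * (13 * m) * (6 * m))).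
    by apply: leq_add; repeat (apply: leq_mul; try lia).
  have : (m * m * m <= H * m)%N by rewrite leq_mul2r mH orbT.
  lia.
move=> f /Dset44_param [].
  move=> [b [d [dH bH ->]]]; rewrite mem_cat; apply/orP; left.
  apply: (allpairs_f (fun b d => Poly [:: d; 0; b; 0; 1]));
    apply: mem_irange => //.
  have : b ^+ 2 < 36 * (m.+1)%:Z ^+ 2.
    apply: le_lt_trans bH _; rewrite ltr_pM2l //.
  have -> : 36 * m.+1%:Z ^+ 2 = (6 * m.+1%:Z) ^+ 2 by ring.
  rewrite -[b ^+ 2]real_normK ?num_real //.
  by rewrite ltr_pXn2r ?nnegrE //; lia.
move=> [a [b [d [k [[dk ak bk] kH ->]]]]]; rewrite mem_cat; apply/orP; right.
have km : `|k| <= m%:Z.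
  by apply: absz_le_root Hm => //; rewrite real_normK ?num_real.
have [e eE ->] : exists2 e : int, e \in [:: 1; -1] & d = e * k ^+ 2.
  rewrite -dk; case: (ger0P d) => _; [exists 1 | exists (-1)] => //.
    by rewrite mul1r.
  by rewrite mulN1r opprK.
apply: (allpairs_f
  (fun ab ek => Poly [:: ek.1 * ek.2 ^+ 2; ek.2 * ab.1; ab.2; ab.1; 1])
  (x := (a, b)) (y := (e, k))).
  by apply: (allpairs_f pair); apply: mem_irange; lia.
by apply: (allpairs_f pair) => //; apply: mem_irange; lia.
Qed.

Lemma D44_ge (R : realType) H m : (0 < m)%N -> (m ^ 2 <= H)%N ->
  (m.+1 * (H./2).+1 <= D R 4 4 H)%N.
Proof.
move=> m0 mH.
pose L : seq {poly int} := [seq Poly [:: d%:Z; 0; b%:Z; 0; 1] |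
  b <- iota 0 m.+1, d <- iota (H - H./2) (H./2).+1].
have -> : (m.+1 * (H./2).+1)%N = size L by rewrite size_allpairs !size_iota.
have mm : (m <= m ^ 2)%N by rewrite -{1}(expn1 m) leq_pexp2l.
apply: D_ge.
  apply: allpairs_uniq; rewrite ?iota_uniq // => -[b d] [b' d'] _ _ /=.
  by move=> /quartic_Poly_inj [[->] _ [->] _].
move=> f /allpairsP [[b d] []]; rewrite !mem_iota /= => bm dH ->.
have bb : (b ^ 2 <= m ^ 2)%N by rewrite leq_exp2r //; lia.
by apply: Dset44_mem; lia.
Qed.

Lemma D43_le (R : realType) H : (0 < H)%N ->
  (D R 4 3 H <= 66 * H + 6 * \sum_(1 <= n < H.+1) (H %/ n))%N.
Proof.
move=> H0; have [m [m0 mH Hm]] := @floor_root 3 H isT H0.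
pose P (n c : int) : {poly int} := Poly [:: - (n * c); c; 0; - n; 1].
pose Q (A : int) (ns : int * int) : {poly int} :=
  Poly [:: - ns.1 * ns.2 ^+ 3; ns.2 ^+ 3 - ns.1 * ns.2 * A;
        ns.2 * A - ns.1 * A; A - ns.1; 1].
(* n = 0 is listed apart: the bound H %/ n on |c| would be 0 for it. *)
pose L1 := [seq P 0 c | c <- irange H].
pose L2 := [seq P n%:Z c | n <- iota 1 H, c <- irange (H %/ n)].
pose L3 := [seq P (- n%:Z) c | n <- iota 1 H, c <- irange (H %/ n)].
pose L4 := [seq Q A ns | A <- irange (3 * m),
  ns <- [seq (n, s) | n <- irange m, s <- irange m]].
have sz2 : sumn [seq size (irange (H %/ n)) | n <- iota 1 H] =
    (\sum_(1 <= n < H.+1) (H %/ n).*2.+1)%N.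
  rewrite sumnE big_map /index_iota subSS subn0.
  by apply: eq_bigr => n _; rewrite size_irange.
have sz3 : (\sum_(1 <= n < H.+1) (H %/ n).*2.+1 <=
    3 * \sum_(1 <= n < H.+1) (H %/ n))%N.
  rewrite big_distrr /= big_nat [X in (_ <= X)%N]big_nat.
  apply: leq_sum => n nH.
  have : (0 < H %/ n)%N by rewrite divn_gt0; lia.
  by lia.
apply: leq_trans (@D_le R 4 3 H (L1 ++ L2 ++ L3 ++ L4) _) _; last first.
  have s1 : size L1 = H.*2.+1 by rewrite size_map size_irange.
  have s2 : size L2 = (\sum_(1 <= n < H.+1) (H %/ n).*2.+1)%N.
    by rewrite size_allpairs_dep sz2.
  have s3 : size L3 = (\sum_(1 <= n < H.+1) (H %/ n).*2.+1)%N.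
    by rewrite size_allpairs_dep sz2.
  have s4 : size L4 = ((3 * m).*2.+1 * (m.*2.+1 * m.*2.+1))%N.
    by rewrite size_allpairs (size_irange (3 * m)) size_allpairs size_irange.
  rewrite (size_cat L1) (size_cat L2) (size_cat L3) s1 s2 s3 s4.
  have : ((3 * m).*2.+1 * (m.*2.+1 * m.*2.+1) <= 63 * H)%N.
    apply: (@leq_trans (7 * m * (3 * m * (3 * m)))).
      by repeat (apply: leq_mul; try lia).
    have : (m * m * m <= H)%N.
      by rewrite (leq_trans _ mH) // !expnS expn0 muln1 mulnA.
    lia.
  by move: sz3; lia.
move=> f /Dset43_param [].
  move=> [n [c [c0 cH ncH ->]]]; rewrite -/(P n c).
  rewrite (mem_cat _ L1) (mem_cat _ L2) (mem_cat _ L3).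
  have [->|n0] := eqVneq n 0.
    by apply/orP; left; apply: (map_f (P 0)); apply: mem_irange.
  apply/orP; right.
  have cn : `|c| <= (H %/ absz n)%N%:Z.
    rewrite -abszE lez_nat leq_divRL ?absz_gt0 // -abszM mulrC.
    by rewrite -lez_nat abszE.
  have nH : (absz n <= H)%N.
    rewrite -lez_nat abszE; apply: le_trans ncH; rewrite normrM ler_peMr //.
    by rewrite -gtz0_ge1 normr_gt0.
  have nI : absz n \in iota 1 H by rewrite mem_iota; lia.
  have [n1|n1] := lerP 0 n.
    apply/orP; left; rewrite -{1}(gez0_abs n1).
    by apply: (allpairs_f_dep (fun n c => P n%:Z c)) => //; apply: mem_irange.
  apply/orP; right; apply/orP; left; rewrite -{1}[n]opprK -(ltz0_abs n1).
  by apply: (allpairs_f_dep (fun n c => P (- n%:Z) c)) => //; apply: mem_irange.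
move=> [A [n [s [[ns As] sH ->]]]].
rewrite (mem_cat _ L1) (mem_cat _ L2) (mem_cat _ L3).
have sm := @absz_le_root 3 H m s isT sH Hm.
do 3 (apply/orP; right).
rewrite -[Poly _]/(Q A (n, s)).
apply: allpairs_f; first by apply: mem_irange; lia.
by apply: (allpairs_f pair); apply: mem_irange; lia.
Qed.

Lemma D43_ge_linear (R : realType) H : (H <= D R 4 3 H)%N.
Proof.
pose F (c : nat) : {poly int} :=
  Poly [:: (0 * c)%N%:Z; - c%:Z; 0; - 0%N%:Z; 1].
have -> : H = size [seq F c | c <- iota 1 H] by rewrite size_map size_iota.
apply: D_ge.
  rewrite map_inj_uniq ?iota_uniq // => x y /quartic_Poly_inj [_ + _ _].
  by move/oppr_inj => [].
move=> f /mapP [c]; rewrite mem_iota => cH ->.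
by apply: Dset43_mem; rewrite size_map size_iota; lia.
Qed.

Lemma D43_ge (R : realType) H m : (m ^ 4 <= H)%N ->
  (\sum_(1 <= n < m.+1) (H %/ n - n ^ 3) <= D R 4 3 H)%N.
Proof.
move=> mH.
pose L : seq {poly int} := [seq Poly [:: (n * c)%N%:Z; - c%:Z; 0; - n%:Z; 1] |
  n <- iota 1 m, c <- iota (n ^ 3).+1 (H %/ n - n ^ 3)].
have -> : (\sum_(1 <= n < m.+1) (H %/ n - n ^ 3))%N = size L.
  rewrite size_allpairs_dep sumnE big_map /index_iota subSS subn0.
  by apply: eq_bigr => n _; rewrite size_iota.
apply: D_ge.
  apply: allpairs_uniq_dep => [|n _|]; rewrite ?iota_uniq //.
  move=> [n c] [n' c'] _ _ /= /quartic_Poly_inj.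
  move=> [_ /oppr_inj [cc] _ /oppr_inj [nn]].
  by rewrite cc nn.
move=> f /allpairsPdep [n [c []]]; rewrite !mem_iota => nm cH ->.
have cn : (c <= H %/ n)%N by lia.
have ncH : (n * c <= H)%N by rewrite mulnC -leq_divRL //; lia.
apply: Dset43_mem => //; apply/andP; split; first by lia.
by rewrite (leq_trans _ ncH) // leq_pmull //; lia.
Qed.

(** * Asymptotics *)

Lemma ln_le_sub1 (R : realType) (x : R) : 0 < x -> ln x <= x - 1.
Proof.
by move=> x0; rewrite -[x in ln x](subrK 1) addrC; apply: le_ln1Dx; lra.
Qed.

Lemma ln_succ_diff (R : realType) (x : R) : 0 < x ->
  (x + 1)^-1 <= ln (x + 1) - ln x <= x^-1.
Proof.
move=> x0; have x1 : 0 < x + 1 by lra.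
have := ln_le_sub1 (divr_gt0 x0 x1); have := ln_le_sub1 (divr_gt0 x1 x0).
rewrite !ln_div ?posrE //.
have -> : (x + 1) / x - 1 = x^-1 by field; lra.
have -> : x / (x + 1) - 1 = - (x + 1)^-1 by field; lra.
by move=> h1 h2; apply/andP; split; lra.
Qed.

Lemma ln_succ_le_harmonic (R : realType) m :
  ln m.+1%:R <= \sum_(1 <= n < m.+1) (n%:R^-1 : R).
Proof.
elim: m => [|m IH]; first by rewrite ln1 big_geq.
rewrite big_nat_recr //= -[m.+2%:R]natr1.
move: IH; have := @ln_succ_diff R m.+1%:R (ltr0Sn _ _).
by move: (\sum_(_ <= _ < _) _) (m.+1%:R : R) => S x /andP [_]; lra.
Qed.

Lemma harmonic_le_ln (R : realType) m :
  \sum_(1 <= n < m.+2) (n%:R^-1 : R) <= 1 + ln m.+1%:R.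
Proof.
elim: m => [|m IH]; first by rewrite ln1 big_nat1 invr1 addr0.
rewrite big_nat_recr //= -[m.+2%:R]natr1.
move: IH; have := @ln_succ_diff R m.+1%:R (ltr0Sn _ _).
by move: (\sum_(_ <= _ < _) _) (m.+1%:R : R) => S x /andP [+ _]; lra.
Qed.

Lemma ln2_ge_half (R : realType) : 1 / 2 <= ln (2 : R).
Proof.
have := @ln_le_sub1 R 2^-1; rewrite lnV ?posrE //; lra.
Qed.

Lemma divn_le (R : realType) (H n : nat) :
  (H %/ n)%:R <= H%:R * n%:R^-1 :> R.
Proof.
case: n => [|n]; first by rewrite divn0 invr0 mulr0.
by rewrite ler_pdivlMr ?ltr0n // -natrM ler_nat leq_divM.
Qed.

Lemma divn_ge (R : realType) (H n : nat) : (0 < n)%N ->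
  H%:R * n%:R^-1 <= (H %/ n)%:R + 1 :> R.
Proof.
move=> n0; rewrite ler_pdivrMr ?ltr0n // natr1 -natrM ler_nat.
by rewrite ltnW // ltn_ceil.
Qed.

Lemma powR_three_halves (R : realType) (H : nat) :
  H%:R `^ (3 / 2) = H%:R * Num.sqrt H%:R :> R.
Proof.
have [->|H0] := eqVneq H 0%N; first by rewrite powR0 ?mul0r //; lra.
have -> : 3 / 2 = 1 + 2^-1 :> R by lra.
rewrite powRD; last by rewrite pnatr_eq0 H0 implybT.
by rewrite powRr1 // powR12_sqrt.
Qed.

Lemma D44_bounds (R : realType) H : (0 < H)%N ->
  2^-1 * (H%:R : R) `^ (3 / 2) <= (D R 4 4 H)%:R <= 777 * (H%:R : R) `^ (3 / 2).
Proof.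
move=> H0; have [m [m0 mH Hm]] := @floor_root 2 H isT H0.
rewrite powR_three_halves; apply/andP; split.
  apply: (@le_trans _ _ (m.+1 * (H./2).+1)%:R); last first.
    by rewrite ler_nat; apply: D44_ge.
  rewrite natrM mulrA mulrC ler_pM //.
    have -> : m.+1%:R = Num.sqrt (m.+1%:R ^+ 2) :> R.
      by rewrite sqrtr_sqr ger0_norm.
    by rewrite ler_sqrt ?exprn_ge0 // -natrX ler_nat ltnW.
  by rewrite ler_pdivrMl // -natrM ler_nat; lia.
apply: (@le_trans _ _ (777 * (H * m))%:R).
  by rewrite ler_nat; apply: D44_le.
rewrite natrM; apply: ler_wpM2l; first exact: ler0n.
rewrite natrM; apply: ler_wpM2l; first exact: ler0n.
have -> : m%:R = Num.sqrt (m%:R ^+ 2) :> R.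
  by rewrite sqrtr_sqr ger0_norm.
by rewrite ler_sqrt // -natrX ler_nat.
Qed.

Lemma D43_upper (R : realType) H : (2 <= H)%N ->
  (D R 4 3 H)%:R <= 150 * (H%:R * ln H%:R) :> R.
Proof.
move=> H2; have H0 : (0 < H)%N by apply: leq_trans H2.
apply: (@le_trans _ _ (66 * H + 6 * \sum_(1 <= n < H.+1) (H %/ n))%N%:R).
  by rewrite ler_nat D43_le.
rewrite natrD !natrM natr_sum.
have hs : \sum_(1 <= n < H.+1) (H %/ n)%:R <= H%:R * (1 + ln H%:R) :> R.
  apply: (@le_trans _ _ (\sum_(1 <= n < H.+1) H%:R * n%:R^-1)).
    by apply: ler_sum => n _; apply: divn_le.
  rewrite -big_distrr /= ler_pM2l ?ltr0n //.
  by rewrite -{2}(prednK H0) -{1}(prednK H0) harmonic_le_ln.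
have l2 : 1 / 2 <= ln H%:R :> R.
  apply: le_trans (ln2_ge_half R) _.
  by rewrite ler_ln ?posrE ?ltr0n // ler_nat.
have H1 : 0 < H%:R :> R by rewrite ltr0n.
have : H%:R * (1 / 2) <= H%:R * ln H%:R :> R by rewrite ler_pM2l.
by move: hs; rewrite mulrDr; lra.
Qed.

Lemma D43_lower (R : realType) H : (2 <= H)%N ->
  12^-1 * (H%:R * ln H%:R) <= (D R 4 3 H)%:R :> R.
Proof.
move=> H2; have H0 : (0 < H)%N by apply: leq_trans H2.
have [m [m0 mH Hm]] := @floor_root 4 H isT H0.
have H1 : 0 < H%:R :> R by rewrite ltr0n.
have N1 : H%:R <= (D R 4 3 H)%:R :> R by rewrite ler_nat D43_ge_linear.
have N2 : \sum_(1 <= n < m.+1) (H%:R * n%:R^-1 - 1 - m%:R ^+ 3) <=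
    (D R 4 3 H)%:R :> R.
  apply: (@le_trans _ _ (\sum_(1 <= n < m.+1) (H %/ n - n ^ 3)%N%:R));
    last first.
    by rewrite -natr_sum ler_nat D43_ge.
  rewrite big_nat [X in _ <= X]big_nat; apply: ler_sum => n /andP [n1 nm].
  have := divn_ge R H n1.
  have : (n ^ 3)%:R <= m%:R ^+ 3 :> R by rewrite -natrX ler_nat leq_exp2r.
  have : (H %/ n)%:R <= (H %/ n - n ^ 3)%N%:R + (n ^ 3)%:R :> R.
    by rewrite -natrD ler_nat; lia.
  lra.
move: N2; rewrite !sumrB -big_distrr /= !sumr_const_nat subSS subn0.
have m4 : m%:R ^+ 3 *+ m <= H%:R :> R.
  by rewrite -mulr_natr -exprSr -natrX ler_nat.
have mleH : 1 *+ m <= H%:R :> R.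
  by rewrite ler_nat (leq_trans _ mH) // -{1}(expn1 m) leq_pexp2l.
have l4 : ln H%:R <= 4 * ln m.+1%:R :> R.
  rewrite mulr_natl -lnXn ?ltr0n // ler_ln ?posrE ?exprn_gt0 ?ltr0n //.
  by rewrite -natrX ler_nat ltnW.
have := ln_succ_le_harmonic R m.
move: (\sum_(_ <= _ < _) _) => S lS.
have : H%:R * ln H%:R <= 4 * (H%:R * S) :> R.
  by rewrite mulrCA ler_pM2l // (le_trans l4) // ler_pM2l.
lra.
Qed.

Theorem corollary1p5 (R : realType) :
  exists c1 c2 : R,
    [/\ 0 < c1, 0 < c2,
        forall H : nat, (1 <= H)%N ->
          (c1 * H%:R <= (D R 3 3 H)%:R <= c2 * H%:R) /\
          (c1 * (H%:R `^ (3 / 2)) <= (D R 4 4 H)%:R <= c2 * (H%:R `^ (3 / 2)))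
      & forall H : nat, (2 <= H)%N ->
          c1 * (H%:R * ln H%:R) <= (D R 4 3 H)%:R <= c2 * (H%:R * ln H%:R)].
Proof.
exists 12^-1, 777; split.
- by rewrite invr_gt0 ltr0n.
- exact: ltr0Sn.
- move=> H H0; have H1 : 0 <= H%:R :> R by apply: ler0n.
  split.
    apply/andP; split.
      have : H%:R <= (D R 3 3 H)%:R :> R by rewrite ler_nat; apply: D33_ge.
      by lra.
    have : (D R 3 3 H)%:R <= (24 * H)%:R :> R by rewrite ler_nat; apply: D33_le.
    by rewrite natrM; lra.
  have /andP [h1 ->] := @D44_bounds R H H0; rewrite andbT.
  apply: le_trans h1; apply: ler_wpM2r; first exact: powR_ge0.
  by lra.
- move=> H H2; rewrite D43_lower //=; apply: (le_trans (D43_upper R H2)).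
  apply: ler_wpM2r; last by lra.
  by rewrite mulr_ge0 ?ler0n // ln_ge0 // ler1n ltnW.
Qed.
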